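(* Let $\mathcal A$ be a von Neumann algebra and let $\sigma,\tau:\mathcal A\to\mathcal A$ be bounded homomorphisms. Let $\mathcal M$ be a Banach $\mathcal A$-module and let $d:\mathcal A\to\mathcal M$ be a bounded linear map such that $d(p^2)=\sigma(p)d(p)+d(p)\tau(p)$ for every projection $p\in\mathcal A$. Then $d$ is a $(\sigma,\tau)$-derivation, i.e. $d(ab)=\sigma(a)d(b)+d(a)\tau(b)$ for all $a,b\in\mathcal A$.
   Context: For a Banach algebra $\mathcal A$, a Banach $\mathcal A$-module is a Banach space $\mathcal M$ that is an $\mathcal A$-bimodule with $\max\{\|ax\|,\|xa\|\}\le\|a\|\|x\|$ for all $a\in\mathcal A$, $x\in\mathcal M$. A homomorphism on $\mathcal A$ is a linear multiplicative map $\mathcal A\to\mathcal A$ (it is not assumed to preserve the involution). A projection is a self-adjoint idempotent. For bounded linear maps $\sigma,\tau:\mathcal A\to\mathcal A$, a linear map $d:\mathcal A\to\mathcal M$ is a $(\sigma,\tau)$-derivation if $d(ab)=\sigma(a)d(b)+d(a)\tau(b)$ for all $a,b\in\mathcal A$. *)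

(* Defs.v *)
From HB Require Import structures.
From mathcomp Require Import all_boot all_order all_algebra.
From mathcomp Require Import sesquilinear complex.
From mathcomp Require Import all_classical all_reals all_analysis.

Set Implicit Arguments.
Unset Strict Implicit.
Unset Printing Implicit Defensive.

Import Order.TTheory GRing.Theory Num.Theory Num.Def.
Import numFieldNormedType.Exports.

Local Open Scope classical_set_scope.
Local Open Scope ring_scope.
Local Open Scope complex_scope.

(* The form is linear in its first argument. *)
HB.mixin Record isHilbert (R : realType) H & CompleteNormedModule R[i] H := {
  dotH : {dot H for @conjC R[i]} ;
  normH_dot : forall x : H, `|x| ^+ 2 = dotH x x
}.

#[short(type="hilbertType")]
HB.structure Definition Hilbert (R : realType) :=
  {H of CompleteNormedModule R[i] H & isHilbert R H}.

Notation "''[' x , y ]" := (dotH x y)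
  (at level 0, format "''[' x ,  y ]") : ring_scope.

Definition bounded_map (K : numFieldType) (V W : normedModType K)
  (f : V -> W) := exists k : K, forall x, `|f x| <= k * `|x|.

Section operators.
Context (R : realType) (H : hilbertType R).

Definition is_adjoint (T S : H -> H) := forall x y : H, '[T x, y] = '[x, S y].

Definition wot_coef (T : H -> H) : {ptws H * H -> R[i]^o} :=
  fun u => '[T u.1, u.2].

(* The weak operator topology is the initial topology for the family of maps
   T |-> '[T x, y]; closedness is relative to the bounded operators. *)
Definition wot_closed (A : set (H -> H)) :=
  forall T, linear T -> bounded_map T ->
    closure (A : set (initial_topology wot_coef)) T -> A T.

Definition opnorm (T : H -> H) : R :=
  sup [set complex.Re `|T x| | x in [set x : H | `|x| <= 1]].

Record vonNeumannAlgebra := VonNeumannAlgebra {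
  vn_set : set (H -> H) ;
  vn_linear : forall T, vn_set T -> linear T ;
  vn_bounded : forall T, vn_set T -> bounded_map T ;
  vn_id : vn_set id ;
  vn_add : forall T S, vn_set T -> vn_set S -> vn_set (T + S) ;
  vn_scale : forall (k : R[i]) T, vn_set T -> vn_set (k *: T) ;
  vn_comp : forall T S, vn_set T -> vn_set S -> vn_set (T \o S) ;
  vn_adj : forall T, vn_set T -> exists2 S, vn_set S & is_adjoint T S ;
  vn_wot_closed : wot_closed vn_set
}.

Record vn_elt (A : vonNeumannAlgebra) := VnElt {
  vn_fun :> H -> H ;
  vn_funP : vn_fun \in vn_set A
}.

Definition vn_pred (A : vonNeumannAlgebra) : pred (H -> H) :=
  fun T => T \in vn_set A.

HB.instance Definition _ A := [isSub of vn_elt A for @vn_fun A].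
HB.instance Definition _ A := [Choice of vn_elt A by <:].

Lemma vn_submod_closed A : GRing.subsemimod_closed (vn_pred A).
Proof.
have Z k T : vn_pred A T -> vn_pred A (k *: T).
  by move=> /set_mem AT; exact/mem_set/vn_scale.
split => //; split => [|T S /set_mem AT /set_mem AS]; last first.
  exact/mem_set/vn_add.
have -> : (0 : H -> H) = (0 : R[i]) *: (id : H -> H).
  by apply/funext => x; rewrite scalrfctE scale0r.
exact/Z/mem_set/vn_id.
Qed.

HB.instance Definition _ A :=
  GRing.isSubmodClosed.Build _ _ (vn_pred A) (vn_submod_closed A).
HB.instance Definition _ A :=
  GRing.SubChoice_isSubLmodule.Build _ _ (vn_pred A) (vn_elt A) (vn_submod_closed A).

Lemma normE_Re (V : normedModType R[i]) (x : V) : (complex.Re `|x|)%:C = `|x|.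
Proof. by rewrite RRe_real ?normr_real. Qed.

Lemma opnorm_le (T : H -> H) (c : R) :
  (forall x : H, `|x| <= 1 -> `|T x| <= c%:C) -> opnorm T <= c.
Proof.
move=> Tc; apply: ge_sup => [|_ /= [x x1 <-]].
  by exists (complex.Re `|T 0|), 0 => //=; rewrite normr0.
by rewrite -lecR normE_Re Tc.
Qed.

Lemma opnorm_ub (T : H -> H) (x : H) :
  bounded_map T -> `|x| <= 1 -> `|T x| <= (opnorm T)%:C.
Proof.
move=> [k Tk] x1; rewrite -normE_Re lecR; apply: ub_le_sup; last by exists x.
exists (complex.Re `|k|) => _ /= [y y1 <-].
rewrite -lecR !normE_Re -[`|T y|]normr_id.
have := Tk y => /[dup] Ty /(le_trans (normr_ge0 _))/ger0_norm kE.
rewrite normr_id (le_trans Ty)// -kE normrM normr_id.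
by rewrite -[leRHS]mulr1 ler_wpM2l.
Qed.

Lemma opnorm_ge0 (T : H -> H) : bounded_map T -> 0 <= opnorm T.
Proof.
move=> bT; rewrite -ler0c; apply: le_trans (normr_ge0 (T 0)) _.
by apply: opnorm_ub => //; rewrite normr0.
Qed.

Section elements.
Variable A : vonNeumannAlgebra.
Implicit Types a b : vn_elt A.

Lemma vn_eltP a : vn_set A (vn_fun a).
Proof. exact/set_mem/vn_funP. Qed.

Lemma vn_elt_inj a b : (forall x, vn_fun a x = vn_fun b x) -> a = b.
Proof. by move=> ab; apply: val_inj; apply/funext. Qed.

Definition vn_one : vn_elt A := VnElt (mem_set (vn_id A)).
Definition vn_mul a b : vn_elt A :=
  VnElt (mem_set (vn_comp (vn_eltP a) (vn_eltP b))).

Lemma vn_mulA : associative vn_mul.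
Proof. by move=> a b c; exact: vn_elt_inj. Qed.
Lemma vn_mul1l : left_id vn_one vn_mul.
Proof. by move=> a; exact: vn_elt_inj. Qed.
Lemma vn_mul1r : right_id vn_one vn_mul.
Proof. by move=> a; exact: vn_elt_inj. Qed.
Lemma vn_mulDl : left_distributive vn_mul +%R.
Proof. by move=> a b c; exact: vn_elt_inj. Qed.
Lemma vn_mulDr : right_distributive vn_mul +%R.
Proof.
move=> a b c; apply: vn_elt_inj => x /=.
have := vn_linear (vn_eltP a) 1 (vn_fun b x) (vn_fun c x).
by rewrite !scale1r.
Qed.

HB.instance Definition _ := GRing.Zmodule_isPzRing.Build (vn_elt A)
  vn_mulA vn_mul1l vn_mul1r vn_mulDl vn_mulDr.

Definition vn_norm a : R[i] := (opnorm (vn_fun a))%:C.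

Lemma vn_normD a b : vn_norm (a + b) <= vn_norm a + vn_norm b.
Proof.
rewrite /vn_norm -rmorphD lecR; apply: opnorm_le => x x1.
rewrite (le_trans (ler_normD _ _))// rmorphD lerD//.
  by apply: opnorm_ub => //; exact/vn_bounded/vn_eltP.
by apply: opnorm_ub => //; exact/vn_bounded/vn_eltP.
Qed.

Lemma vn_normZ_le (k : R[i]) a : vn_norm (k *: a) <= `|k| * vn_norm a.
Proof.
have kE : (complex.Re `|k|)%:C = `|k| by rewrite RRe_real ?normr_real.
rewrite /vn_norm -kE -rmorphM lecR.
apply: opnorm_le => x x1.
rewrite rmorphM /= kE [leLHS]normrZ ler_wpM2l//.
by apply: opnorm_ub => //; exact/vn_bounded/vn_eltP.
Qed.

Lemma vn_normZ (k : R[i]) a : vn_norm (k *: a) = `|k| * vn_norm a.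
Proof.
apply/le_anti/andP; split; first exact: vn_normZ_le.
have [->|k0] := eqVneq k 0.
  by rewrite normr0 mul0r ler0c opnorm_ge0//; exact/vn_bounded/vn_eltP.
rewrite -ler_pdivlMl ?normr_gt0// -normfV (le_trans _ (vn_normZ_le _ _))//.
by rewrite scalerA mulVf// scale1r.
Qed.

Lemma vn_norm0_eq0 a : vn_norm a = 0 -> a = 0.
Proof.
move=> a0; apply: vn_elt_inj => x.
have bT := vn_bounded (vn_eltP a).
have [->|x0] := eqVneq x 0.
  case: bT => k /(_ 0); rewrite normr0 mulr0 normr_le0 => /eqP ->.
  by [].
have nx0 : `|x| != 0 by rewrite normr_eq0.
have := @opnorm_ub (vn_fun a) (`|x|^-1 *: x) bT.
rewrite normrZ normfV normr_id mulVf// => /(_ (lexx _)).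
rewrite -/(vn_norm a) a0 normr_le0 => /eqP.
have := vn_linear (vn_eltP a) (`|x|^-1) x 0.
rewrite addr0 => ->.
have -> : vn_fun a 0 = 0.
  by case: bT => k /(_ 0); rewrite normr0 mulr0 normr_le0 => /eqP.
by rewrite addr0 => /eqP; rewrite scaler_eq0 invr_eq0 (negbTE nx0) => /eqP.
Qed.

HB.instance Definition _ := Lmodule_isNormed.Build R[i] (vn_elt A)
  vn_normD vn_normZ vn_norm0_eq0.

End elements.

End operators.

Coercion vn_elt : vonNeumannAlgebra >-> Sortclass.

Section modules.
Context (R : realType) (H : hilbertType R) (A : vonNeumannAlgebra H).

Definition is_projection (p : A) := p ^+ 2 = p /\ is_adjoint p p.

Record banachModule (M : completeNormedModType R[i]) := BanachModule {
  lact : {bilinear A -> M -> M} ;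
  ract : {bilinear M -> A -> M} ;
  lactM : forall a b x, lact (a * b) x = lact a (lact b x) ;
  ractM : forall x a b, ract x (a * b) = ract (ract x a) b ;
  lractA : forall a x b, ract (lact a x) b = lact a (ract x b) ;
  norm_lact : forall a x, `|lact a x| <= `|a| * `|x| ;
  norm_ract : forall a x, `|ract x a| <= `|a| * `|x|
}.

Definition is_derivation (M : completeNormedModType R[i]) (act : banachModule M)
    (sigma tau : A -> A) (d : A -> M) :=
  forall a b, d (a * b) = lact act (sigma a) (d b) + ract act (d a) (tau b).

End modules.

(* Main.v *)
(* Let E(a,b) = d(ab) - sigma(a)d(b) - d(a)tau(b).  Expanding the hypothesis on
   sums of orthogonal projections kills the symmetrization of E on commuting
   projections.  For a self-adjoint contraction a, the element s = sign a is a
   difference of projections commuting with the commutant of a, and 2a - s is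
   again a contraction; iterating, a bounded linear map that vanishes on
   projections of the bicommutant of a vanishes at a.  Hence d is a Jordan
   (sigma,tau)-derivation.
   If p x = 0 = x q, the Jordan identities give p d(xyx) q = 0 for all y, and x is
   a norm limit of elements xyx, namely x - x(1 - x^* x)^n; so p d(x) q = 0.
   A bounded bilinear F with F(u,v) = 0 whenever uv = 0 satisfies
   F(uc,v) = F(u,cv): this holds for c a projection, hence for all c.  Applied
   twice to p d(x) q = 0 it yields the derivation identity between sigma(1) and
   tau(1), and the Jordan identity for the pair (1,b) recovers d(b) from there. *)

From HB Require Import structures.
Require Import Defs.
From mathcomp Require Import all_boot all_order all_algebra.
From mathcomp Require Import sesquilinear complex.
From mathcomp Require Import all_classical all_reals all_analysis.
From mathcomp Require Import ring lra.

Set Implicit Arguments.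
Unset Strict Implicit.
Unset Printing Implicit Defensive.

Import Order.TTheory GRing.Theory Num.Theory.
Import numFieldNormedType.Exports.

Local Open Scope ring_scope.

(** * The real inner product and strong limits *)

Section RealInnerProduct.
Context (R : realType) (H : hilbertType R).
Implicit Types x y z : H.

(** The order of [R[i]] is partial; the real part gives a symmetric real form whose inequalities are
    settled in [R]. *)
Definition ip x y : R := complex.Re '[x, y].

Lemma ipDl x y z : ip (x + y) z = ip x z + ip y z.
Proof. by rewrite /ip linearDl /=; case: '[x, z] => a b; case: '[y, z]. Qed.

Lemma ipNl x z : ip (- x) z = - ip x z.
Proof. by rewrite /ip linearNl /=; case: '[x, z]. Qed.

Lemma ipC x y : ip x y = ip y x.
Proof. apply: (@complexI R); rewrite /ip !complexRe hermC expr0 mul1r.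
exact: Re_conj. Qed.

Lemma ipDr z x y : ip z (x + y) = ip z x + ip z y.
Proof. by rewrite !(ipC z) ipDl. Qed.

Lemma ipNr z x : ip z (- x) = - ip z x.
Proof. by rewrite !(ipC z) ipNl. Qed.

Lemma ipZl (k : R) x y : ip (k%:C%C *: x) y = k * ip x y.
Proof.
by rewrite /ip linearZl_LR /=; case: '[x, y] => a b /=; rewrite mul0r subr0.
Qed.

Lemma ipZr (k : R) x y : ip y (k%:C%C *: x) = k * ip y x.
Proof. by rewrite !(ipC y) ipZl. Qed.

Lemma sqr_normE x : `|x| ^+ 2 = (ip x x)%:C%C.
Proof. by rewrite /ip -normH_dot RRe_real// realX// normr_real. Qed.

Lemma ip_ge0 x : 0 <= ip x x.
Proof. by rewrite -ler0c -sqr_normE exprn_ge0. Qed.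

Lemma ip_eq0 x : ip x x = 0 -> x = 0.
Proof.
by move=> x0; apply/eqP; rewrite -normr_eq0 -sqrf_eq0 sqr_normE x0.
Qed.

Lemma ler_norm_ip x y : (`|x| <= `|y|) = (ip x x <= ip y y).
Proof. by rewrite -lecR -!sqr_normE ler_sqr ?nnegrE. Qed.

Lemma dot_CS x y : `|'[x, y]| <= `|x| * `|y|.
Proof.
rewrite -ler_sqr ?nnegrE ?mulr_ge0// exprMn.
have [->|y0] := eqVneq y 0; first by rewrite linear0r !normr0 !expr0n mulr0.
have yp : 0 < `|y| ^+ 2 by rewrite exprn_gt0// normr_gt0.
(* The square expands to [b * (a * b - c * c')], where [a] and [b] are the squared norms of [x] and
   [y], and [c] is their product. *)
have := exprn_ge0 2 (normr_ge0 (`|y| ^+ 2 *: x - '[x, y] *: y)).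
rewrite !normH_dot linearBl !linearBr !linearZl_LR !linearZr_LR /= -!normH_dot.
rewrite (hermC _ y x) expr0 mul1r normCK.
rewrite (CrealP (realX _ _)) ?normr_real//.
set a := `|x| ^+ 2; set b := `|y| ^+ 2; set c := '[x, y]; set c' := c^*.
rewrite [X in 0 <= X -> _](_ : _ = b * (a * b - c * c')); last first.
  by rewrite /GRing.scale /= -[Num.conj_op _]/c'; ring.
by rewrite pmulr_rge0// subr_ge0.
Qed.

Lemma ip_CS x y : `|ip x y|%:C%C <= `|x| * `|y|.
Proof. exact: le_trans (normc_ge_Re _) (dot_CS x y). Qed.

End RealInnerProduct.

Section Limits.
Context (R : realType) (H : hilbertType R).
Local Open Scope classical_set_scope.

Lemma cvg_dist (V W : normedModType R[i]) (u : nat -> V) (l : V) (v : nat -> W)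
    (m : W) (k : R[i]) :
  (forall n, `|m - v n| <= k * `|l - u n|) -> u @ \oo --> l -> v @ \oo --> m.
Proof.
move=> uv /cvgrPdist_le ul; apply/cvgrPdist_le => e e0.
have k0 : 0 < `|k| + 1 by rewrite ltr_wpDl.
near=> n.
rewrite (le_trans (uv n))//.
have [->|z] := eqVneq `|l - u n| 0; first by rewrite mulr0 ltW.
have ln : 0 < `|l - u n| by rewrite lt_neqAle eq_sym z normr_ge0.
(* [k] is an arbitrary scalar; it is real because its product with a positive distance dominates a
   norm. *)
have kr : k \is Num.real.
  rewrite -(mulfK z k) realM ?realV ?normr_real//.
  by rewrite ger0_real// (le_trans _ (uv n)).
rewrite (@le_trans _ _ ((`|k| + 1) * `|l - u n|))//.
  by rewrite ler_wpM2r// (le_trans (real_ler_norm kr))// lerDl.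
rewrite -ler_pdivlMl//; near: n; apply: ul.
by rewrite mulr_gt0// invr_gt0.
Unshelve. all: by end_near. Qed.

Lemma cvg_ipl (u : nat -> H) l y :
  u @ \oo --> l -> ip (u n) y @[n --> \oo] --> ip l y.
Proof.
move=> /cvgrPdist_le ul; apply/cvgrPdist_le => e e0.
have yp : 0 < `|y| + 1 by rewrite ltr_wpDl.
near=> n.
rewrite -lecR -ipNl -ipDl (le_trans (ip_CS _ _))//.
rewrite (@le_trans _ _ (`|l - u n| * (`|y| + 1)))//.
  by rewrite ler_wpM2l// lerDl.
rewrite -ler_pdivlMr//; near: n; apply: ul.
by rewrite mulr_gt0 ?invr_gt0// ltcR.
Unshelve. all: by end_near. Qed.

(** The squared norms form a bounded monotone real sequence whose increments dominate squared
    distances, so [u] is Cauchy. *)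
Lemma cvg_ip_increasing (u : nat -> H) (M : R) :
  (forall n m, (n <= m)%N ->
    ip (u m - u n) (u m - u n) <= ip (u m) (u m) - ip (u n) (u n)) ->
  (forall n, ip (u n) (u n) <= M) -> cvg (u @ \oo).
Proof.
move=> uinc uM; pose r n := ip (u n) (u n).
have rinc : {homo r : n m / (n <= m)%N >-> n <= m}.
  move=> n m /uinc nm; rewrite -subr_ge0; exact: le_trans (ip_ge0 _) nm.
have /cvgrPdist_lt rl : cvg (r @ \oo).
  by apply: nondecreasing_is_cvgn => //; exists M => _ [n _ <-]; exact: uM.
apply/cauchy_cvgP/cauchy_exP => e e0.
have eE : e = (complex.Re e)%:C%C by rewrite RRe_real// gtr0_real.
have e'0 : 0 < complex.Re e by rewrite -ltcR -eE.
have [N _ rN] := rl _ (exprn_gt0 2 e'0).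
exists (u N), N => // n /= Nn.
rewrite -ball_normE /= -ltr_sqr ?nnegrE ?(ltW e0)// distrC.
rewrite sqr_normE eE -rmorphXn ltcR.
rewrite (le_lt_trans (uinc _ _ Nn))//.
have rn : r n <= lim (r @ \oo).
  apply: nondecreasing_cvgn_le => //; exact/cvgrPdist_lt.
have := rN N (leqnn N); rewrite /= ger0_norm ?subr_ge0; last first.
  exact: le_trans (rinc _ _ Nn) rn.
by apply: le_lt_trans; rewrite lerB.
Qed.

End Limits.

(** * Elements of a von Neumann algebra and the sign of a self-adjoint one *)

Section Operators.
Context (R : realType) (H : hilbertType R) (A : vonNeumannAlgebra H).
Implicit Types (a b c : A) (x y : H).

Lemma vn_fun_linear a : linear (vn_fun a).
Proof. exact/vn_linear/vn_eltP. Qed.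

HB.instance Definition _ a :=
  GRing.isLinear.Build R[i] H H *:%R (vn_fun a) (vn_fun_linear a).

Lemma vnDE a b x : (a + b) x = a x + b x. Proof. by []. Qed.
Lemma vnNE a x : (- a) x = - a x. Proof. by []. Qed.
Lemma vnME a b x : (a * b) x = a (b x). Proof. by []. Qed.
Lemma vn1E x : (1 : A) x = x. Proof. by []. Qed.
Lemma vnZE (k : R[i]) a x : (k *: a) x = k *: a x. Proof. by []. Qed.

Definition vnE := (vnDE, vnNE, vnME, vn1E, vnZE).

Lemma vn_norm_ub a x : `|a x| <= `|a| * `|x|.
Proof.
have [->|x0] := eqVneq x 0; first by rewrite raddf0 !normr0 mulr0.
have nx0 : 0 < `|x| by rewrite normr_gt0.
have := @opnorm_ub _ _ a (`|x|^-1 *: x) (vn_bounded (vn_eltP a)).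
rewrite linearZ !normrZ normfV normr_id mulVf ?gt_eqF// => /(_ (lexx _)).
by rewrite ler_pdivrMl// mulrC.
Qed.

Lemma vn_norm_le a (k : R) : 0 <= k -> (forall x, `|a x| <= k%:C%C * `|x|) ->
  `|a| <= k%:C%C.
Proof.
move=> k0 ak; rewrite lecR; apply: opnorm_le => x x1.
by rewrite (le_trans (ak x))// -[leRHS]mulr1 ler_wpM2l// ler0c.
Qed.

Lemma vn_normM a b : `|a * b| <= `|a| * `|b|.
Proof.
have kE : (complex.Re (`|a| * `|b|))%:C%C = `|a| * `|b|.
  by rewrite RRe_real// realM// normr_real.
rewrite -kE; apply: vn_norm_le => [|x]; first by rewrite -ler0c kE mulr_ge0.
rewrite kE vnME -mulrA (le_trans (vn_norm_ub _ _))// ler_wpM2l//.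
exact: vn_norm_ub.
Qed.

Definition contractive a := forall x, ip (a x) (a x) <= ip x x.

Lemma contractiveP a : contractive a <-> `|a| <= 1.
Proof.
split=> [ca|a1 x]; last first.
  rewrite -ler_norm_ip (le_trans (vn_norm_ub a x))//.
  by rewrite -[leRHS]mul1r ler_wpM2r.
apply: (@vn_norm_le a 1) => // x; rewrite mul1r ler_norm_ip; exact: ca.
Qed.

Lemma vn_adjP a : exists b, is_adjoint a b.
Proof.
have [S AS aS] := vn_adj (vn_eltP a).
by exists (VnElt (mem_set AS)).
Qed.

Lemma ip_adj a b : is_adjoint a b -> forall x y, ip (a x) y = ip x (b y).
Proof. by move=> ab x y; rewrite /ip ab. Qed.

(** The imaginary part of a product is the real part after multiplying the second vector by i, so
    real parts determine the form. *)
Lemma is_adjoint_ip a b : (forall x y, ip (a x) y = ip x (b y)) -> is_adjoint a b.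
Proof.
move=> ab x y; have ImE u v : complex.Im '[u, v] = ip u ('i%C *: v).
  rewrite /ip linearZr_LR /= /GRing.scale /= complexiE conjCi -complexiE.
  by rewrite mulNr mulrC raddfN /= ReiNIm opprK.
have Reab : complex.Re '[a x, y] = complex.Re '[x, b y] := ab x y.
have Imab : complex.Im '[a x, y] = complex.Im '[x, b y].
  by rewrite !ImE ab linearZ.
by rewrite [LHS]complexE [RHS]complexE Reab Imab.
Qed.

End Operators.

(** * Strong limits of contractive elements *)

Section Sign.
Context (R : realType) (H : hilbertType R) (A : vonNeumannAlgebra H).
Implicit Types (a b c s u : A) (x y : H).
Local Open Scope classical_set_scope.

Lemma cvg_ip_le (v : nat -> H) (l y : H) (k : R) :
  v @ \oo --> l -> (forall n, ip (v n) y <= k) -> ip l y <= k.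
Proof.
move=> /cvg_ipl vl vk; apply: (closed_cvg (fun r => r <= k)) (vl y).
- exact: closed_le.
- by near=> n; exact: vk.
Unshelve. all: by end_near. Qed.

Lemma ip_le_cvg (v : nat -> H) (l y : H) (k : R) :
  v @ \oo --> l -> (forall n, k <= ip (v n) y) -> k <= ip l y.
Proof.
move=> vl kv; rewrite -lerN2 -ipNr; apply: (cvg_ip_le vl) => n.
by rewrite ipNr lerN2.
Qed.

Lemma cvg_vn a (v : nat -> H) (l : H) :
  v @ \oo --> l -> a (v n) @[n --> \oo] --> a l.
Proof.
apply: (@cvg_dist _ _ _ _ _ _ _ `|a|) => n.
by rewrite -raddfB; exact: vn_norm_ub.
Qed.

(** Contractivity makes the error [t n (l - v n)] tend to 0. This lets products of iterates pass to
    the strong limit. *)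
Lemma cvg_contractive (t : nat -> A) s (v : nat -> H) (l : H) :
  (forall n, contractive (t n)) -> (forall x, t n x @[n --> \oo] --> s x) ->
  v @ \oo --> l -> t n (v n) @[n --> \oo] --> s l.
Proof.
move=> ct ts vl; have -> : (fun n => t n (v n)) = (fun n => t n l - t n (l - v n)).
  by apply/funext => n; rewrite raddfB subKr.
rewrite -[s l]subr0; apply: cvgB => //.
apply: (cvg_dist (k := 1) _ vl) => n.
by rewrite sub0r normrN mul1r ler_norm_ip; exact: ct.
Qed.

(** By Cauchy-Schwarz the coefficients converge pointwise; weak closedness then keeps strong limits
    in the algebra. *)
Lemma cvg_wot (t : nat -> H -> H) (s : H -> H) :
  (forall x, t n x @[n --> \oo] --> s x) ->
  (t @ \oo : set_system (initial_topology (@wot_coef R H))) -->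
    (s : initial_topology (@wot_coef R H)).
Proof.
move=> ts V [_ [[B Bop <-] Bs sBfA]].
have ptws : (@wot_coef R H (t n)) @[n --> \oo] --> @wot_coef R H s.
  apply/pointwise_cvgP => -[x y] /=.
  apply: (cvg_dist (k := `|y|) _ (ts x)) => n /=.
  by rewrite -linearBl mulrC; exact: dot_CS.
have : \forall n \near \oo, B (wot_coef (t n)).
  by apply: ptws; apply: open_nbhs_nbhs; split.
by apply: filterS => n /sBfA.
Qed.

Lemma strong_limit_vn (t : nat -> A) :
  (forall n, contractive (t n)) -> (forall x, cvg (t n x @[n --> \oo])) ->
  exists2 s : A, contractive s & forall x, t n x @[n --> \oo] --> s x.
Proof.
move=> ct cvt; pose S x := lim (t n x @[n --> \oo]).
have tS x : t n x @[n --> \oo] --> S x by exact: cvt.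
have linS : linear S.
  move=> k x y.
  have tL : t n (k *: x + y) @[n --> \oo] --> k *: S x + S y.
    have -> : (fun n => t n (k *: x + y)) = (fun n => k *: t n x + t n y).
      by apply/funext => n; exact: vn_fun_linear.
    by apply: cvgD => //; exact: cvgZr.
  exact: (norm_cvg_unique (tS _) tL).
have cS x : ip (S x) (S x) <= ip x x.
  (* The limit is taken in [ip (t n x) (S x)], with the second vector fixed; half the sum of the
     squared norms bounds it. *)
  have : ip (S x) (S x) <= 2^-1 * (ip x x + ip (S x) (S x)).
    apply: (cvg_ip_le (tS x)) => n.
    have := ip_ge0 (t n x - S x); have := ct n x.
    by rewrite ipDl !ipDr !ipNl !ipNr (ipC (S x) (t n x)); lra.
  by lra.
have AS : vn_set A S.
  apply: vn_wot_closed => //.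
    by exists 1 => x; rewrite mul1r ler_norm_ip.
  rewrite closureEcvg; exists ((fun n => t n : H -> H) @ \oo).
    exact: fmap_proper_filter.
  split; first exact: cvg_wot.
  by move=> B AB; exists 0%N => // n _; apply: AB; exact: vn_eltP.
by exists (VnElt (mem_set AS)).
Qed.

End Sign.

(** * The sign of a self-adjoint contraction by polynomial iteration *)

Section SignIteration.
Context (R : realType) (H : hilbertType R) (A : vonNeumannAlgebra H).
Implicit Types (a b c s u : A) (x y : H).
Local Open Scope classical_set_scope.

Lemma vn_scalerAl (k : R[i]) a b : (k *: a) * b = k *: (a * b).
Proof. exact: vn_elt_inj. Qed.

Lemma vn_scalerAr (k : R[i]) a b : a * (k *: b) = k *: (a * b).
Proof. by apply: vn_elt_inj => x; rewrite !vnE linearZ. Qed.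

Lemma adj1 : is_adjoint (1 : A) (1 : A).
Proof. by []. Qed.

Lemma adjD a a' b b' :
  is_adjoint a a' -> is_adjoint b b' -> is_adjoint (a + b : A) (a' + b' : A).
Proof. by move=> aa' bb' x y; rewrite !vnE linearDl linearDr /= aa' bb'. Qed.

Lemma adjB a a' b b' :
  is_adjoint a a' -> is_adjoint b b' -> is_adjoint (a - b : A) (a' - b' : A).
Proof. by move=> aa' bb' x y; rewrite !vnE linearBl linearBr /= aa' bb'. Qed.

Lemma adjM a a' b b' :
  is_adjoint a a' -> is_adjoint b b' -> is_adjoint (a * b : A) (b' * a' : A).
Proof. by move=> aa' bb' x y; rewrite !vnE aa' bb'. Qed.

Lemma adjZ (k : R) a a' :
  is_adjoint a a' -> is_adjoint (k%:C%C *: a : A) (k%:C%C *: a' : A).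
Proof.
by move=> aa'; apply: is_adjoint_ip => x y; rewrite !vnE ipZl ipZr (ip_adj aa').
Qed.

Definition defect s : A := 1 - s * s.
(* The increment s u^2 = u s u, with u = defect s, is a congruence: this makes the
   products of iterates increasing without extracting square roots, as the usual
   Newton step s (3 - s^2) / 2 would require. *)
Definition sign_step s : A := s + s * (defect s * defect s).

Lemma adj_defect s : is_adjoint s s -> is_adjoint (defect s) (defect s).
Proof. by move=> ss; apply: adjB; [exact: adj1|exact: adjM]. Qed.

Lemma comm_defect b s : GRing.comm b s -> GRing.comm b (defect s).
Proof. by move=> bs; apply: commrB; [exact: commr1|exact: commrM]. Qed.

Lemma comm_sign_step b s : GRing.comm b s -> GRing.comm b (sign_step s).
Proof.
by move=> bs; apply: commrD => //; do 2?[apply: commrM => //]; exact: comm_defect.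
Qed.

Lemma adj_sign_step s : is_adjoint s s -> is_adjoint (sign_step s) (sign_step s).
Proof.
move=> ss; have us := adj_defect ss; apply: adjD => //.
rewrite [X in is_adjoint _ (vn_fun X)](_ : _ = (defect s * defect s) * s).
  by apply: adjM => //; exact: adjM.
by apply: commrM; exact/comm_defect/commr_refl.
Qed.

Lemma ip_defect_ge0 s x : is_adjoint s s -> contractive s -> 0 <= ip (defect s x) x.
Proof.
by move=> ss cs; rewrite !vnE ipDl ipNl (ip_adj ss) subr_ge0; exact: cs.
Qed.

(** With u = 1 - s^2 >= 0 the claim is (1 - u)(1 + u^2)^2 <= 1, and 1 - (1 - u)(1 + u^2)^2 = u(1 -
    u)^2 + u(u - u^2)^2 + u^4. *)
Lemma contractive_sign_step s : is_adjoint s s -> contractive s ->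
  contractive (sign_step s).
Proof.
move=> ss cs x; set u := defect s.
have us := ip_adj (adj_defect ss); rewrite -/u in us.
have E y : ip (s y) (s y) = ip y y - ip (u y) y.
  by rewrite !vnE ipDl ipNl opprB addrC (ip_adj ss (s y)) subrK.
have u_ge0 y : 0 <= ip (u y) y by exact: ip_defect_ge0.
have -> : sign_step s x = s (x + u (u x)) by rewrite raddfD.
rewrite {}E; clearbody u.
have := u_ge0 (x - u x); have := u_ge0 (u x - u (u x)).
rewrite !raddfB raddfD /=.
set x1 := u x; set x2 := u x1; set x3 := u x2.
have h1 : ip x2 x = ip x1 x1 by rewrite us.
have h2 : ip x3 x = ip x2 x1 by rewrite us.
have h3 : ip x3 x1 = ip x2 x2 by rewrite us.
have := ip_ge0 x2.
rewrite !(ipDl, ipDr, ipNl, ipNr) (ipC x x2) (ipC x1 x2) h1 h2 h3.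
lra.
Qed.

End SignIteration.

Section SignElement.
Context (R : realType) (H : hilbertType R) (A : vonNeumannAlgebra H).
Implicit Types (b s u : A) (x y : H).
Local Open Scope classical_set_scope.

Context (a : A) (saa : is_adjoint a a) (ca : contractive a).

(** On [-1, 1] the scalar map s + s(1 - s^2)^2 moves points away from 0 and fixes exactly -1, 0 and
    1, so its iterates tend to the sign. *)
Let t n : A := iter n (@sign_step R H A) a.

Let comm_t b n : GRing.comm b a -> GRing.comm b (t n).
Proof. by move=> ba; elim: n => //= n; exact: comm_sign_step. Qed.

Let sat n : is_adjoint (t n) (t n).
Proof. by elim: n => //= n; exact: adj_sign_step. Qed.

Let ct n : contractive (t n).
Proof. by elim: n => //= n; apply: contractive_sign_step; exact: sat. Qed.

(** The increment [u * s * u] has [u] commuting with [t n], so it contributes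
    [ip (s (u x)) (t n (u x))], nonnegative by the induction hypothesis at [u x]. *)
Let t_incr n m x : (n <= m)%N -> ip (t n x) (t n x) <= ip (t m x) (t n x).
Proof.
move=> /subnK <-; elim: (m - n)%N x => [//|k IHk] x; rewrite addSn.
set s := t (k + n); set u := defect s.
have us : GRing.comm u s by apply/commr_sym/comm_defect/commr_refl.
have ut : GRing.comm u (t n).
  apply/commr_sym/comm_defect/comm_t/commr_sym/comm_t/commr_refl.
have -> : t (k + n).+1 x = s x + u (s (u x)).
  by rewrite -[u (s (u x))]/((u * (s * u)) x) mulrA us -mulrA.
rewrite ipDl; apply: ler_wpDr; last exact: IHk.
rewrite (ip_adj (adj_defect (sat _))) -/s -/u.
rewrite -[u (t n x)]/((u * t n) x) ut.
exact: le_trans (ip_ge0 _) (IHk _).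
Qed.

(** Expanding the squared distance, [t_incr] bounds it by the increment of the squared norms. *)
Let t_cvg x : cvg (t n x @[n --> \oo]).
Proof.
apply: (@cvg_ip_increasing _ _ _ (ip x x)) => [n m nm|n]; last exact: ct.
have := t_incr x nm.
by rewrite ipDl !ipDr !ipNl !ipNr (ipC (t n x) (t m x)); lra.
Qed.

(** The strong limit [s] of the iterates works. The last clause holds since [t_incr] from index 0
    gives [ip (a x) (a x) <= ip (s x) (a x)], whence |(2a - s) x| <= |s x|. *)
Lemma exists_sign : exists s : A, [/\ is_adjoint s s, s * s * s = s,
  forall b, GRing.comm b a -> GRing.comm b s & contractive (a + a - s)].
Proof.
have [s cs ts] := strong_limit_vn ct t_cvg.
have ss : is_adjoint s s.
  apply: is_adjoint_ip => x y.
  have lx := cvg_ipl (y := y) (ts x); have ly := cvg_ipl (y := x) (ts y).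
  rewrite (ipC x); apply: (norm_cvg_unique lx).
  have -> // : (fun n => ip (t n x) y) = (fun n => ip (t n y) x).
  by apply/funext => n; rewrite (ip_adj (@sat n)) ipC.
have comm_s b : GRing.comm b a -> GRing.comm b s.
  move=> ba; apply: vn_elt_inj => x.
  rewrite !vnME; apply: (norm_cvg_unique (cvg_vn (a := b) (ts x))).
  have -> : (fun n => b (t n x)) = (fun n => t n (b x)).
    by apply/funext => n; rewrite -!vnME comm_t.
  exact: ts.
exists s; split => //; last first.
  move=> x; rewrite !vnE.
  have : ip (a x) (a x) <= ip (s x) (a x).
    by apply: (ip_le_cvg (ts x)) => n; exact: (@t_incr 0 n).
  have := cs x.
  by rewrite !(ipDl, ipDr, ipNl, ipNr) (ipC (a x) (s x)); have := ca x; lra.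
have tu v l : v @ \oo --> l -> defect (t n) (v n) @[n --> \oo] --> defect s l.
  by move=> vl; apply: cvgB => //; do 2?apply: (cvg_contractive ct ts).
(* The recursion for [t n.+1] passes to the limit, so [s] is a fixed point of the step. *)
have suu : s * (defect s * defect s) = 0.
  apply: vn_elt_inj => x; apply: (addrI (s x)); rewrite addr0.
  have lim1 : t n.+1 x @[n --> \oo] --> s x.
    by rewrite (cvg_shiftS (fun n => t n x)).
  have lim2 : t n x + t n (defect (t n) (defect (t n) x)) @[n --> \oo] -->
      s x + s (defect s (defect s x)).
    apply: cvgD => //; apply: (cvg_contractive ct ts).
    apply/tu/tu; exact: cvg_cst.
  exact: (norm_cvg_unique lim2 lim1).
have us : GRing.comm (defect s) s by apply/commr_sym/comm_defect/commr_refl.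
(* With u = 1 - s^2, the squared norm of s u x is the product of x with s u^2 s x, which is 0. *)
have su0 : s * defect s = 0.
  apply: vn_elt_inj => x; apply: (@ip_eq0 _ _ ((s * defect s) x)).
  rewrite (ip_adj (adjM ss (adj_defect ss))) -[(defect s * s) _]vnME.
  rewrite (_ : _ * _ = s * (defect s * defect s) * s); last first.
    by rewrite us -!mulrA us.
  by rewrite suu mul0r /ip linear0r.
move: su0; rewrite /defect mulrBr mulr1 mulrA => /eqP.
by rewrite subr_eq0 => /eqP.
Qed.

End SignElement.

(** * Bounded linear maps vanishing on projections *)

Lemma bounded_multiples_eq0 (R : realType) (c K : R[i]) :
  0 <= c -> (forall n, c * n%:R <= K) -> c = 0.
Proof.
(* Comparison with 0 in [R[i]] forces [c] and [K] to be real, and the Archimedean property of [R]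
   applies. *)
move=> c0 cK; have cE : c = (complex.Re c)%:C%C by rewrite RRe_real// ger0_real.
have KE : K = (complex.Re K)%:C%C.
  by rewrite RRe_real// ger0_real// (le_trans _ (cK 0%N))// mulr0.
move: c0 cK; rewrite cE KE ler0c; set r := complex.Re c; set k := complex.Re K.
move=> r0 rk; apply/eqP; rewrite -[_ == _]/(_ == 0%:C%C) (inj_eq (@complexI R)).
have {}rk n : r * n%:R <= k by rewrite -lecR rmorphM /= rmorph_nat.
rewrite eq_le r0 andbT leNgt; apply/negP => rp.
have k0 : 0 <= k / r by rewrite divr_ge0// (le_trans _ (rk 0%N))// mulr0.
have := archi_boundP k0.
by rewrite ltr_pdivrMr// mulrC => /lt_le_trans /(_ (rk _)); rewrite ltxx.
Qed.

Lemma bounded_map_ge0 (K : numFieldType) (V W : normedModType K) (f : V -> W) :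
  bounded_map f -> exists2 k : K, 0 <= k & forall x, `|f x| <= k * `|x|.
Proof.
move=> [k fk]; exists `|k| => // x.
by rewrite -[`|x|]normr_id -normrM ger0_norm// (le_trans _ (fk x)).
Qed.

Section SpectralVanishing.
Context (R : realType) (H : hilbertType R) (A : vonNeumannAlgebra H).
Implicit Types (a b p s : A).

Lemma contractive_scaling a :
  exists2 r : R, r%:C%C != 0 :> R[i] & contractive (r%:C%C *: a).
Proof.
pose r := complex.Re `|a| + 1.
have r0 : 0 < r by rewrite ltr_wpDl// -ler0c normE_Re.
exists r^-1.
  by rewrite -(rmorph0 (real_complex R)) (inj_eq (@complexI R)) invr_eq0 gt_eqF.
apply/contractiveP; rewrite normrZ.
rewrite ger0_norm ?ler0c ?invr_ge0 ?(ltW r0)// -[`|a|]normE_Re -rmorphM /= mulrC.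
by rewrite -[1]/(1%:C%C) lecR ler_pdivrMr// mul1r lerDl.
Qed.

Lemma sign_projections s : is_adjoint s s -> s * s * s = s ->
  exists p q : A, [/\ is_projection p, is_projection q, s = p - q &
    forall b, GRing.comm b s -> GRing.comm b p /\ GRing.comm b q].
Proof.
move=> ss s3; set h : R[i] := ((2^-1 : R)%:C)%C.
have h2 : h + h = 1.
  by rewrite -rmorphD /= -(rmorph1 (real_complex R)); congr (_%:C)%C; lra.
have hh : h * h + h * h = h by rewrite -mulrDr h2 mulr1.
have commZ b c : GRing.comm b c -> GRing.comm b (h *: c).
  by move=> bc; rewrite /GRing.comm vn_scalerAr vn_scalerAl bc.
have ss2 : is_adjoint (s * s : A) (s * s : A) by exact: adjM.
have e2 : s * s * (s * s) = s * s by rewrite mulrA s3.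
have se : s * (s * s) = s by rewrite mulrA s3.
(* These are the spectral projections of [s] for the eigenvalues 1 and -1. *)
exists (h *: (s * s + s)), (h *: (s * s - s)); split.
- split; last by apply: adjZ; exact: adjD.
  rewrite expr2 vn_scalerAr vn_scalerAl scalerA.
  rewrite mulrDr !mulrDl e2 se s3 [s + s * s]addrC scalerDr -scalerDl hh.
  by [].
- split; last by apply: adjZ; exact: adjB.
  rewrite expr2 vn_scalerAr vn_scalerAl scalerA.
  rewrite mulrBr !mulrBl e2 se s3 -[s - s * s]opprB opprK scalerDr -scalerDl hh.
  by [].
- rewrite -scalerBr opprB addrC addrA subrK.
  by rewrite scalerDr -scalerDl h2 scale1r.
move=> b bs; split; apply: commZ; first apply: commrD => //; first exact: commrM.
by apply: commrB => //; exact: commrM.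
Qed.

Context (M : normedModType R[i]) (phi : A -> M).
Context (phi_linear : linear phi) (phi_bounded : bounded_map phi).

HB.instance Definition _ := GRing.isLinear.Build R[i] A M *:%R phi phi_linear.

(* With a_(n+1) = 2 a_n - sign a_n, phi vanishes at each sign a_n, so that
   2^n phi a = phi a_n stays bounded. *)
Let vanish_contractive a : is_adjoint a a -> contractive a ->
  (forall p, is_projection p ->
     (forall b, GRing.comm b a -> GRing.comm b p) -> phi p = 0) ->
  phi a = 0.
Proof.
move=> saa ca phip.
have iter_a n : exists a', [/\ is_adjoint a' a', contractive a',
    forall b, GRing.comm b a -> GRing.comm b a' & phi a *+ (2 ^ n) = phi a'].
  elim: n => [|n [a' [saa' ca' aa' phia']]]; first by exists a; rewrite expn0.
  have [s [ss s3 a's cs]] := exists_sign saa' ca'.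
  have [p [q [pp pq spq sc]]] := sign_projections ss s3.
  exists (a' + a' - s); split => // [|b ba|].
  - by apply: adjB => //; exact: adjD.
  - by apply: commrB; [apply: commrD; exact: aa'|exact/a's/aa'].
  have cp b : GRing.comm b a -> GRing.comm b p by move=> /aa'/a's/sc[].
  have cq b : GRing.comm b a -> GRing.comm b q by move=> /aa'/a's/sc[].
  have phi_s : phi s = 0.
    by rewrite spq raddfB /= (phip p)// (phip q)// subrr.
  rewrite raddfB raddfD /= phi_s subr0.
  by rewrite expnS mulnC mulrnA phia' mulr2n.
have [k k0 phik] := bounded_map_ge0 phi_bounded.
apply/eqP; rewrite -normr_eq0; apply/eqP.
apply: (@bounded_multiples_eq0 _ _ k) => // n.
have [a' [_ /contractiveP ca' _ phia']] := iter_a n.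
rewrite (@le_trans _ _ `|phi a'|)//.
  rewrite -phia' normrMn -[leRHS]mulr_natr ler_wpM2l// ler_nat.
  by rewrite ltnW// ltn_expl.
by rewrite (le_trans (phik a'))// -[leRHS]mulr1 ler_wpM2l.
Qed.

(** Only projections in the bicommutant of [a] relative to [A] are tested, so two applications to
    the same [a] meet only commuting projections. *)
Lemma vanish_self_adjoint a : is_adjoint a a ->
  (forall p, is_projection p ->
     (forall b, GRing.comm b a -> GRing.comm b p) -> phi p = 0) ->
  phi a = 0.
Proof.
move=> saa phip; have [r r0 cra] := contractive_scaling a.
suff : phi (r%:C%C *: a) = 0.
  by rewrite linearZ => /eqP; rewrite scaler_eq0 (negbTE r0) => /eqP.
apply: vanish_contractive => //; first exact: adjZ.
move=> p pp pa; apply: phip => // b ba; apply: pa.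
by rewrite /GRing.comm vn_scalerAr vn_scalerAl ba.
Qed.

End SpectralVanishing.

(** * Adjoints, and approximation of v by elements v y v *)

Section Sandwich.
Context (R : realType) (H : hilbertType R) (A : vonNeumannAlgebra H).
Implicit Types (a b v w : A) (x y : H).

Lemma adjC a b : is_adjoint a b -> is_adjoint b a.
Proof.
by move=> ab; apply: is_adjoint_ip => x y; rewrite ipC -(ip_adj ab) ipC.
Qed.

(** Since [ip (a (b x)) x] is the squared norm of [b x], expanding |a b x - x|^2 >= 0 gives the
    bound. *)
Lemma adj_contractive a b : is_adjoint a b -> contractive a -> contractive b.
Proof.
move=> ab ca x; have := ip_ge0 (a (b x) - x); have := ca (b x).
have e : ip (a (b x)) x = ip (b x) (b x) by rewrite (ip_adj ab).
by rewrite !(ipDl, ipDr, ipNl, ipNr) (ipC x) e; lra.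
Qed.

Lemma self_adjoint_decomposition a : exists h k : A,
  [/\ is_adjoint h h, is_adjoint k k & a = h + 'i%C *: k].
Proof.
have [a' aa'] := vn_adjP a; have a'a := adjC aa'.
have sk : is_adjoint (- 'i%C *: (a - a') : A) (- 'i%C *: (a - a') : A).
  move=> x y; rewrite !vnE !linearZl_LR !linearZr_LR /= !linearBl !linearBr /=.
  by rewrite aa' a'a rmorphN /= complexiE conjCi opprK /GRing.scale /=; ring.
have sh : is_adjoint (a + a' : A) (a + a' : A).
  by have := adjD aa' a'a; rewrite [a' + a]addrC.
set h : R[i] := (2^-1)%:C%C; set i : R[i] := 'i%C in sk *.
have h2 : h * 2%:R = 1.
  by rewrite -(rmorph_nat (real_complex R)) -rmorphM mulVf ?pnatr_eq0.
have i2 : i * i = -1 by rewrite -expr2 sqr_i.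
exists (h *: (a + a')), (h *: (- i *: (a - a'))).
split; [exact: adjZ|exact: adjZ|].
rewrite !scalerA mulrN mulrAC i2 mulN1r opprK -scalerDr.
by rewrite addrACA subrr addr0 -mulr2n -scaler_nat scalerA h2 scale1r.
Qed.

(** For w = 1 - v^* v, the element v w^n has the form v - v y v, and its norm is at most 1 / sqrt n
    when n > 0. *)
Lemma sandwich_approx v n : contractive v ->
  exists y : A, `|v - v * y * v| ^+ 2 * n%:R <= 1.
Proof.
move=> cv; have [v' vv'] := vn_adjP v.
have v'v := adjC vv'; have cv' := adj_contractive vv' cv.
pose w : A := 1 - v' * v.
have wE x : ip (w x) (w x) <= ip x x - ip (v x) (v x).
  have e : ip x (v' (v x)) = ip (v x) (v x) by rewrite (ip_adj vv').
  have := cv' (v x).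
  by rewrite !vnE !(ipDl, ipDr, ipNl, ipNr) (ipC (v' (v x))) e; lra.
have vwE x : ip (v (w x)) (v (w x)) <= ip (v x) (v x).
  have -> : v (w x) = v x - v (v' (v x)) by rewrite raddfB.
  set z := v x.
  have e : ip z (v (v' z)) = ip (v' z) (v' z) by rewrite (ip_adj v'v).
  have := cv (v' z); have := ip_ge0 (v' z).
  by rewrite !(ipDl, ipDr, ipNl, ipNr) (ipC (v (v' z)) z) e; lra.
(* The squared norms of v w^k x decrease by [vwE], and [wE] makes their sum telescope below |x|^2;
   so k times the last is bounded. *)
have vwn k x : ip (v ((w ^+ k) x)) (v ((w ^+ k) x)) * k%:R +
    ip ((w ^+ k) x) ((w ^+ k) x) <= ip x x.
  elim: k => [|k IHk]; first by rewrite mulr0 add0r.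
  apply: le_trans IHk; rewrite exprS vnME; set z := (w ^+ k) x.
  have := ler_wpM2r (ler0n R k.+1) (vwE z); have := wE z.
  by rewrite -natr1 mulrDr mulr1; lra.
have [y yE] : exists y : A, v - v * y * v = v * w ^+ n.
  elim: n {vwn} => [|k [y yE]]; first by exists 0; rewrite mulr0 mul0r subr0 mulr1.
  (* This is read off from expanding (v - v y v)(1 - v' v). *)
  exists (y + v' - y * v * v').
  rewrite exprSr mulrA -yE /w [RHS]mulrBr mulr1 [(v - _) * _ in RHS]mulrBl.
  rewrite [v * (_ - _)]mulrBr [v * (_ + _)]mulrDr mulrBl mulrDl !mulrA.
  by rewrite -[X in v - X = _]addrA opprD addrA.
exists y; rewrite yE; case: n {yE} => [|n]; first by rewrite mulr0.
have n0 : 0 < n.+1%:R :> R by rewrite ltr0n.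
have : `|v * w ^+ n.+1| <= (Num.sqrt (n.+1%:R^-1))%:C%C.
  apply: vn_norm_le => [|x]; first exact: sqrtr_ge0.
  rewrite -ler_sqr ?nnegrE ?mulr_ge0 ?ler0c ?sqrtr_ge0// exprMn !sqr_normE.
  rewrite -rmorphXn /= sqr_sqrtr ?invr_ge0 ?ler0n// -rmorphM lecR.
  rewrite ler_pdivlMl// mulrC (le_trans _ (vwn n.+1 x))// lerDl.
  exact: ip_ge0.
have r0 : 0 <= (Num.sqrt (n.+1%:R^-1 : R))%:C%C by rewrite ler0c sqrtr_ge0.
rewrite -[X in is_true X -> _]ler_sqr ?nnegrE//.
rewrite -[X in _ <= X -> _](rmorphXn (real_complex R)) sqr_sqrtr.
  move=> /(ler_wpM2r (ler0n _ n.+1)) /le_trans; apply.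
  by rewrite -(rmorph_nat (real_complex R)) -rmorphM lecR mulVf// gt_eqF.
by rewrite invr_ge0 ler0n.
Qed.

Context (M : normedModType R[i]) (phi : A -> M).
Context (phi_linear : linear phi) (phi_bounded : bounded_map phi).

HB.instance Definition _ := GRing.isLinear.Build R[i] A M *:%R phi phi_linear.

(** After scaling [v] to a contraction, [phi v] equals [phi (v - v * y * v)], which
    [sandwich_approx] makes arbitrarily small. *)
Lemma vanish_sandwich v : (forall y : A, phi (v * y * v) = 0) -> phi v = 0.
Proof.
wlog cv : v / contractive v => [wlg phiv|phiv].
  have [r r0 crv] := contractive_scaling v.
  suff : phi (r%:C%C *: v) = 0.
    by rewrite linearZ => /eqP; rewrite scaler_eq0 (negbTE r0) => /eqP.
  apply: wlg => // y.
  by rewrite vn_scalerAr !vn_scalerAl !linearZ /= phiv !scaler0.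
have [k k0 phik] := bounded_map_ge0 phi_bounded.
apply/eqP; rewrite -normr_eq0 -sqrf_eq0; apply/eqP.
apply: (@bounded_multiples_eq0 _ _ (k ^+ 2)) => [|n]; first exact: exprn_ge0.
have [y yn] := sandwich_approx n cv.
have -> : phi v = phi (v - v * y * v) by rewrite raddfB /= phiv subr0.
rewrite (@le_trans _ _ (k ^+ 2 * (`|v - v * y * v| ^+ 2 * n%:R)))//.
  rewrite mulrA ler_wpM2r// -exprMn ler_sqr ?nnegrE ?mulr_ge0//; exact: phik.
by rewrite -[leRHS]mulr1 ler_wpM2l// exprn_ge0.
Qed.

End Sandwich.

(** * From projections to the derivation identity *)

(** Kept as an unbundled predicate so that it applies to lambda terms obtained by freezing one
    argument. *)
Definition bounded_linear (K : numFieldType) (V W : normedModType K) (f : V -> W) :=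
  linear f /\ bounded_map f.

Lemma addrr_inj (K : numFieldType) (V : lmodType K) (m n : V) :
  m + m = n + n -> m = n.
Proof.
move=> /eqP; rewrite -subr_eq0 opprD addrACA -mulr2n -scaler_nat scaler_eq0.
by rewrite pnatr_eq0 /= subr_eq0 => /eqP.
Qed.

Section BoundedLinear.
Context (K : numFieldType) (U V W : normedModType K).

Lemma bounded_linearD (f g : V -> W) : bounded_linear f -> bounded_linear g ->
  bounded_linear (fun x => f x + g x).
Proof.
move=> [fl /bounded_map_ge0[k k0 fk]] [gl /bounded_map_ge0[l l0 gl']].
split=> [c x y|]; first by rewrite fl gl scalerDr addrACA.
by exists (k + l) => x; rewrite mulrDl (le_trans (ler_normD _ _))// lerD.
Qed.

Lemma bounded_linearN (f : V -> W) : bounded_linear f ->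
  bounded_linear (fun x => - f x).
Proof.
move=> [fl [k fk]]; split=> [c x y|]; first by rewrite fl opprD scalerN.
by exists k => x; rewrite normrN.
Qed.

Lemma bounded_linear_comp (f : V -> W) (g : U -> V) :
  bounded_linear f -> bounded_linear g -> bounded_linear (fun x => f (g x)).
Proof.
move=> [fl /bounded_map_ge0[k k0 fk]] [gl [l gl']].
split=> [c x y|]; first by rewrite gl fl.
exists (k * l) => x; rewrite -mulrA (le_trans (fk _))// ler_wpM2l//.
Qed.

End BoundedLinear.

(** * Bilinear maps vanishing on zero products *)

Section ZeroProduct.
Context (R : realType) (H : hilbertType R) (A : vonNeumannAlgebra H).
Context (M : normedModType R[i]).
Implicit Types (a b c u v p : A).

Lemma bounded_linear_mull a : bounded_linear (fun b : A => a * b).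
Proof.
split=> [k b c|]; first by rewrite mulrDr vn_scalerAr.
by exists `|a| => b; exact: vn_normM.
Qed.

Lemma bounded_linear_mulr a : bounded_linear (fun b : A => b * a).
Proof.
split=> [k b c|]; first by rewrite mulrDl vn_scalerAl.
by exists `|a| => b; rewrite mulrC; exact: vn_normM.
Qed.

Lemma vanish_projections (phi : A -> M) : bounded_linear phi ->
  (forall p, is_projection p -> phi p = 0) -> forall a, phi a = 0.
Proof.
move=> [phil phib] phip a.
have sa0 (h : A) : is_adjoint h h -> phi h = 0.
  by move=> hh; apply: (vanish_self_adjoint phil phib hh) => p pp _; exact: phip.
have [h [k [hh kk ->]]] := self_adjoint_decomposition a.
by rewrite addrC phil !sa0// scaler0 addr0.
Qed.

(** For a projection p both sides equal F(up, pv), because (up)(v - pv) = 0 and (u - up)(pv) = 0.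
    Both sides are bounded and linear in [c], so projections suffice. *)
Lemma zero_product_balanced (F : A -> A -> M) :
  (forall v, bounded_linear (F^~ v)) -> (forall u, bounded_linear (F u)) ->
  (forall u v, u * v = 0 -> F u v = 0) ->
  forall u c v, F (u * c) v = F u (c * v).
Proof.
move=> Fl Fr F0 u c v; apply/eqP; rewrite -subr_eq0; apply/eqP; move: c.
apply: vanish_projections => [|p [p2 _]].
  apply: bounded_linearD.
    exact: (bounded_linear_comp (Fl v) (bounded_linear_mull u)).
  apply: bounded_linearN.
  exact: (bounded_linear_comp (Fr u) (bounded_linear_mulr v)).
rewrite expr2 in p2.
have Dl x y w : F (x + y) w = F x w + F y w.
  by have := (Fl w).1 1 x y; rewrite !scale1r.
have Dr w x y : F w (x + y) = F w x + F w y.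
  by have := (Fr w).1 1 x y; rewrite !scale1r.
have -> : F (u * p) v = F (u * p) (p * v).
  rewrite -[X in F _ X = _](subrK (p * v)) Dr F0 ?add0r//.
  by rewrite mulrBr -!mulrA (mulrA p p) p2 subrr.
have -> : F u (p * v) = F (u * p) (p * v).
  rewrite -[X in F X _ = _](subrK (u * p)) Dl F0 ?add0r//.
  by rewrite mulrBl -!mulrA (mulrA p p) p2 subrr.
by rewrite subrr.
Qed.

End ZeroProduct.

(** * The Jordan identity *)

Section Derivation.
Context (R : realType) (H : hilbertType R) (A : vonNeumannAlgebra H).
Context (sigma tau : {linear A -> A}).
Context (sigmaM : {morph sigma : a b / a * b}).
Context (sigma_bounded : bounded_map sigma).
Context (tauM : {morph tau : a b / a * b}) (tau_bounded : bounded_map tau).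
Context (M : completeNormedModType R[i]) (act : banachModule A M).
Context (d : {linear A -> M}).
Context (d_bounded : bounded_map d)
  (d_proj : forall p : A, is_projection p ->
     d (p ^+ 2) = lact act (sigma p) (d p) + ract act (d p) (tau p)).
Implicit Types (a b c p q r x y : A) (m n : M).

(** The actions twisted by [sigma] and [tau]. They need not be unital: [L 1] acts through the
    idempotent [sigma 1], and similarly on the right. *)
Let L a m := lact act (sigma a) m.
Let Q m a := ract act m (tau a).

Let LM a b m : L (a * b) m = L a (L b m).
Proof. by rewrite /L sigmaM lactM. Qed.
Let QM m a b : Q m (a * b) = Q (Q m a) b.
Proof. by rewrite /Q tauM ractM. Qed.
Let LQ a m b : Q (L a m) b = L a (Q m b).
Proof. by rewrite /L /Q lractA. Qed.
Let LDl a b m : L (a + b) m = L a m + L b m.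
Proof. by rewrite /L linearD linearDl. Qed.
Let LDr a m n : L a (m + n) = L a m + L a n.
Proof. by rewrite /L linearDr. Qed.
Let L0l m : L 0 m = 0.
Proof. by rewrite /L linear0 linear0l. Qed.
Let L0r a : L a 0 = 0.
Proof. by rewrite /L linear0r. Qed.
Let QDl m n a : Q (m + n) a = Q m a + Q n a.
Proof. by rewrite /Q linearDl. Qed.
Let QDr m a b : Q m (a + b) = Q m a + Q m b.
Proof. by rewrite /Q linearD linearDr. Qed.
Let Q0l a : Q 0 a = 0.
Proof. by rewrite /Q linear0l. Qed.
Let Q0r m : Q m 0 = 0.
Proof. by rewrite /Q linear0 linear0r. Qed.

Let bl_d : bounded_linear d.
Proof. by split=> //; exact: linearP. Qed.

Let bl_L a : bounded_linear (L a).
Proof.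
split=> [k m n|]; first by rewrite /L linearPr.
by exists `|sigma a| => m; exact: norm_lact.
Qed.

Let bl_Q a : bounded_linear (Q^~ a).
Proof.
split=> [k m n|]; first by rewrite /Q linearPl.
by exists `|tau a| => m; exact: norm_ract.
Qed.

Let bl_Ll m : bounded_linear (L^~ m).
Proof.
split=> [k a b|]; first by rewrite /L linearP linearPl.
have [k k0 sk] := bounded_map_ge0 sigma_bounded.
exists (k * `|m|) => a; rewrite (le_trans (norm_lact _ _ _))//.
by rewrite mulrAC ler_wpM2r.
Qed.

Let bl_Qr m : bounded_linear (Q m).
Proof.
split=> [k a b|]; first by rewrite /Q linearP linearPr.
have [k k0 tk] := bounded_map_ge0 tau_bounded.
exists (k * `|m|) => a; rewrite (le_trans (norm_ract _ _ _))//.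
by rewrite mulrAC ler_wpM2r.
Qed.

(** The obstruction to the derivation identity; it is bounded and linear in each argument, so the
    vanishing lemmas apply to it. *)
Let E a b := d (a * b) - L a (d b) - Q (d a) b.
Let Es a b := E a b + E b a.

Let bl_E1 b : bounded_linear (E^~ b).
Proof.
apply: bounded_linearD; first apply: bounded_linearD.
- exact: (bounded_linear_comp bl_d (bounded_linear_mulr b)).
- by apply: bounded_linearN; exact: bl_Ll.
- by apply: bounded_linearN; exact: (bounded_linear_comp (bl_Q b) bl_d).
Qed.

Let bl_E2 a : bounded_linear (E a).
Proof.
apply: bounded_linearD; first apply: bounded_linearD.
- exact: (bounded_linear_comp bl_d (bounded_linear_mull a)).
- by apply: bounded_linearN; exact: (bounded_linear_comp (bl_L a) bl_d).
- by apply: bounded_linearN; exact: bl_Qr.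
Qed.

Let bl_Es a : bounded_linear (Es a).
Proof. by apply: bounded_linearD. Qed.

Let EDl a b c : E (a + b) c = E a c + E b c.
Proof. by have := (bl_E1 c).1 1 a b; rewrite !scale1r. Qed.

Let EDr a b c : E a (b + c) = E a b + E a c.
Proof. by have := (bl_E2 a).1 1 b c; rewrite !scale1r. Qed.

Let EsC a b : Es a b = Es b a.
Proof. exact: addrC. Qed.

Let EsDr a b c : Es a (b + c) = Es a b + Es a c.
Proof. by rewrite /Es EDl EDr addrACA. Qed.

Let EsDl a b c : Es (a + b) c = Es a c + Es b c.
Proof. by rewrite !(EsC _ c) EsDr. Qed.

Let E_proj p : is_projection p -> E p p = 0.
Proof. by move=> pp; rewrite /E -expr2 d_proj// -addrA -opprD subrr. Qed.

(** The sum of the two projections is again a projection, and expanding [E] on it leaves the cross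
    terms. *)
Let Es_orthogonal p q : is_projection p -> is_projection q ->
  p * q = 0 -> q * p = 0 -> Es p q = 0.
Proof.
move=> pp qq pq qp; have pDq : is_projection (p + q).
  split; last exact: adjD pp.2 qq.2.
  by rewrite expr2 mulrDr !mulrDl pq qp -!expr2 pp.1 qq.1 addr0 add0r.
have := E_proj pDq; rewrite EDl !EDr (E_proj pp) (E_proj qq) addr0 add0r.
by [].
Qed.

(** With r = pq, the projections p - r, q - r and r are mutually orthogonal, and p = (p - r) + r, q
    = (q - r) + r. *)
Let Es_commuting p q : is_projection p -> is_projection q ->
  GRing.comm p q -> Es p q = 0.
Proof.
move=> pp qq pq; set r := p * q.
have p2 : p * p = p by rewrite -expr2 pp.1.
have q2 : q * q = q by rewrite -expr2 qq.1.
have r2 : r * r = r by rewrite /r {2}pq mulrA -(mulrA p) q2 -mulrA -pq mulrA p2.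
have pr : p * r = r by rewrite /r mulrA p2.
have rp : r * p = r by rewrite /r -mulrA -pq mulrA p2.
have qr : q * r = r by rewrite /r pq mulrA q2.
have rq : r * q = r by rewrite /r -mulrA q2.
have rproj : is_projection r.
  by split; [rewrite expr2|rewrite /r {2}pq; apply: adjM pp.2 qq.2].
have psub x : is_projection x -> x * r = r -> r * x = r -> is_projection (x - r).
  move=> xx xr rx; split; last exact: adjB xx.2 rproj.2.
  by rewrite expr2 mulrBr !mulrBl xr rx r2 -expr2 xx.1 subrr subr0.
have Pp := psub _ pp pr rp; have Pq := psub _ qq qr rq.
rewrite -[p](subrK r) -[q](subrK r) EsDl !(EsDr _ (q - r)).
have ? : (p - r) * (q - r) = 0 by rewrite mulrBr !mulrBl -/r pr r2 rq !subrr.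
have ? : (q - r) * (p - r) = 0.
  by rewrite mulrBr !mulrBl qr rp r2 -pq -/r !subrr.
have ? : (p - r) * r = 0 by rewrite mulrBl pr r2 subrr.
have ? : r * (p - r) = 0 by rewrite mulrBr rp r2 subrr.
have ? : (q - r) * r = 0 by rewrite mulrBl qr r2 subrr.
have ? : r * (q - r) = 0 by rewrite mulrBr rq r2 subrr.
rewrite (Es_orthogonal Pp Pq)// (Es_orthogonal Pp rproj)//.
by rewrite (Es_orthogonal rproj Pq)// /Es (E_proj rproj) !addr0.
Qed.

(** Spectral vanishing is applied in each argument in turn, leaving two projections in the
    bicommutant of [a], which commute. *)
Let E_self_adjoint a : is_adjoint a a -> E a a = 0.
Proof.
move=> aa; apply: addrr_inj; rewrite addr0 -[LHS]/(Es a a).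
apply: (vanish_self_adjoint (bl_Es a).1 (bl_Es a).2 aa) => q qq qa.
rewrite EsC; apply: (vanish_self_adjoint (bl_Es q).1 (bl_Es q).2 aa) => p pp pa.
apply: Es_commuting => //; apply: pa; apply/commr_sym/qa; exact: commr_refl.
Qed.

(** Polarization covers pairs of self-adjoint elements; real and imaginary parts give the rest. *)
Let Es0 a b : Es a b = 0.
Proof.
have sa2 x y : is_adjoint x x -> is_adjoint y y -> Es x y = 0.
  move=> xx yy; have := E_self_adjoint (adjD xx yy).
  by rewrite EDl !EDr !E_self_adjoint// addr0 add0r.
have sa1 x : is_adjoint x x -> Es x b = 0.
  move=> xx; have [h [k [hh kk ->]]] := self_adjoint_decomposition b.
  by rewrite addrC (bl_Es x).1 !sa2// scaler0 addr0.
have [h [k [hh kk ->]]] := self_adjoint_decomposition a.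
by rewrite EsC addrC (bl_Es b).1 !(EsC b) !sa1// scaler0 addr0.
Qed.

(** * From the Jordan identity to the derivation identity *)

Let jordan a b :
  d (a * b + b * a) = L a (d b) + Q (d a) b + (L b (d a) + Q (d b) a).
Proof.
rewrite linearD; apply/eqP; rewrite -subr_eq0 -(Es0 a b) /Es /E.
by rewrite opprD addrACA !opprD !addrA.
Qed.

(** The conditions on [x] kill the two terms of the Jordan identity that contain [d b]. *)
Let jordan_sandwich p x q b : p * x = 0 -> x * q = 0 ->
  L p (Q (d (x * b + b * x)) q) =
  L p (Q (d x) (b * q)) + L (p * b) (Q (d x) q).
Proof.
move=> px xq; rewrite jordan !QDl !LDr !LQ -!LM px L0l add0r.
by rewrite -!QM xq Q0r L0r addr0.
Qed.

(** By [vanish_sandwich] it is enough to treat xyx. Two uses of [jordan_sandwich], for x with xy +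
    yx and for x^2 with y, have equal right-hand sides. *)
Let zero_sandwich p x q : p * x = 0 -> x * q = 0 -> L p (Q (d x) q) = 0.
Proof.
move=> px xq.
have [phil phib] : bounded_linear (fun z => L p (Q (d z) q)).
  exact: (bounded_linear_comp (bl_L p) (bounded_linear_comp (bl_Q q) bl_d)).
apply: (vanish_sandwich phil phib (v := x)) => y.
have phiD a b : L p (Q (d (a + b)) q) = L p (Q (d a) q) + L p (Q (d b) q).
  by rewrite linearD QDl LDr.
have pxx : p * (x * x) = 0 by rewrite mulrA px mul0r.
have xxq : x * x * q = 0 by rewrite -mulrA xq mulr0.
have dxx : d (x * x) = L x (d x) + Q (d x) x.
  by apply: addrr_inj; rewrite -linearD jordan.
have e1 := jordan_sandwich (x * y + y * x) px xq.
have e2 := jordan_sandwich y pxx xxq.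
(* The Jordan formula for 2xyx: with a.b = ab + ba, it is x.(x.y) - (x^2).y. *)
have e12 : x * (x * y + y * x) + (x * y + y * x) * x =
    (x * x * y + y * (x * x)) + (x * y * x + x * y * x).
  by rewrite mulrDr mulrDl !mulrA [X in _ + X = _]addrC addrACA.
apply: addrr_inj; rewrite addr0 -phiD.
apply: (addrI (L p (Q (d (x * x * y + y * (x * x))) q))).
rewrite addr0 -phiD -e12 e1 e2 dxx.
rewrite !mulrDl !mulrDr !QDr !QDl !LDr !LDl.
rewrite !mulrA px mul0r L0l add0r -[y * x * q]mulrA xq mulr0 Q0r L0r addr0.
rewrite !LQ -!LM -!QM !mulrA px L0l add0r.
by rewrite xq Q0r L0r addr0.
Qed.

(** If uv = 0 then vy is killed by u on the left and by q on the right, so [zero_sandwich] supplies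
    the zero-product condition for [F]. *)
Let left_balanced a b y q : y * q = 0 ->
  L (a * b) (Q (d y) q) = L a (Q (d (b * y)) q).
Proof.
move=> yq; pose F u v := L u (Q (d (v * y)) q).
have Fl v : bounded_linear (F^~ v) by exact: bl_Ll.
have Fr u : bounded_linear (F u).
  apply: bounded_linear_comp (bl_L u) _.
  apply: bounded_linear_comp (bl_Q q) _.
  exact: bounded_linear_comp bl_d (bounded_linear_mulr y).
have F0 u v : u * v = 0 -> F u v = 0.
  move=> uv; apply: zero_sandwich; first by rewrite mulrA uv mul0r.
  by rewrite -mulrA yq mulr0.
by have := zero_product_balanced Fl Fr F0 a b 1; rewrite /F mulr1 mul1r.
Qed.

(** Compressing d(1) = L 1 (d 1) + Q (d 1) 1 by [L 1] and by [Q] at 1 gives X = X + X. *)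
Let d1 : L 1 (Q (d 1) 1) = 0.
Proof.
have e : d 1 = L 1 (d 1) + Q (d 1) 1.
  by apply: addrr_inj; rewrite -linearD -[1 in LHS]mulr1 jordan.
have := congr1 (fun m => L 1 (Q m 1)) e.
rewrite QDl LDr LQ -LM -QM mulr1 => /eqP.
by rewrite -[eqbLHS]addr0 => /eqP/addrI.
Qed.

(** By [left_balanced], [F] vanishes on zero products; then [F c 1 = F 1 c] is the claim, as [d1]
    removes the term with [d 1]. *)
Let corner_derivation b c :
  L 1 (Q (d (b * c)) 1) = L b (Q (d c) 1) + L 1 (Q (d b) c).
Proof.
pose F u v := L b (Q (d u) v) - L 1 (Q (d (b * u)) v).
have Fl v : bounded_linear (F^~ v).
  apply: bounded_linearD; last apply: bounded_linearN.
    apply: bounded_linear_comp (bl_L b) _.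
    exact: bounded_linear_comp (bl_Q v) bl_d.
  apply: bounded_linear_comp (bl_L 1) _.
  apply: bounded_linear_comp (bl_Q v) _.
  exact: bounded_linear_comp bl_d (bounded_linear_mull b).
have Fr u : bounded_linear (F u).
  apply: bounded_linearD; last apply: bounded_linearN.
    exact: bounded_linear_comp (bl_L b) (bl_Qr _).
  exact: bounded_linear_comp (bl_L 1) (bl_Qr _).
have F0 u v : u * v = 0 -> F u v = 0.
  by move=> uv; rewrite /F -(left_balanced 1 b uv) mul1r subrr.
have := zero_product_balanced Fl Fr F0 1 c 1.
have bd1 : L b (Q (d 1) c) = 0.
  by rewrite -[b]mulr1 -[c]mul1r LM QM -LQ d1 Q0l L0r.
rewrite /F !mulr1 mul1r bd1 sub0r => /eqP.
by rewrite subr_eq [- _ + _]addrC => /eqP ->; rewrite subrK.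
Qed.

(** The Jordan identity for (1, b), compressed on either side, expresses [d b] through its corner
    [L 1 (Q (d b) 1)] and terms in [d 1]. *)
Lemma jordan_projection_derivation : is_derivation act sigma tau d.
Proof.
have d1l b : L b (Q (d 1) 1) = 0 by rewrite -[b]mulr1 LM d1 L0r.
have d1r b : L 1 (Q (d 1) b) = 0 by rewrite -[b]mul1r QM -LQ d1 Q0l.
have d1m b c : L b (Q (d 1) c) = 0 by rewrite -[b]mulr1 LM d1r L0r.
have d2 b : d b + d b = L 1 (d b) + Q (d 1) b + (L b (d 1) + Q (d b) 1).
  by rewrite -linearD -jordan mul1r mulr1.
have Ld b : L 1 (d b) = L b (d 1) + L 1 (Q (d b) 1).
  have := congr1 (L 1) (d2 b).
  by rewrite !LDr -!LM !mul1r d1r addr0 => /addrI.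
have Qd b : Q (d b) 1 = Q (d 1) b + L 1 (Q (d b) 1).
  have := congr1 (Q^~ 1) (d2 b).
  rewrite /= !QDl -!QM !mulr1 !LQ d1l add0r => /addIr e.
  by rewrite [RHS]addrC.
have dE b : d b = L b (d 1) + Q (d 1) b + L 1 (Q (d b) 1).
  apply: addrr_inj; rewrite d2 Ld [X in _ + (_ + X) = _]Qd.
  by rewrite [X in X + _ = _]addrAC [X in _ + X = _]addrA.
(* All three values of [d] are replaced by [dE]; the mixed terms [L b (Q (d 1) c)] vanish by
   [d1m]. *)
move=> b c; rewrite -/(L b (d c)) -/(Q (d b) c).
rewrite [d (b * c)]dE corner_derivation [d c in RHS]dE [d b in RHS]dE.
rewrite !LDr !QDl LQ d1m addr0 add0r -LM -QM !LQ.
by rewrite -LM -QM mulr1 mul1r [RHS]addrACA.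
Qed.

End Derivation.

Theorem theorem2p2 (R : realType) (H : hilbertType R) (A : vonNeumannAlgebra H)
    (sigma tau : {linear A -> A})
    (sigmaM : {morph sigma : a b / a * b}) (sigma_bounded : bounded_map sigma)
    (tauM : {morph tau : a b / a * b}) (tau_bounded : bounded_map tau)
    (M : completeNormedModType R[i]) (act : banachModule A M)
    (d : {linear A -> M}) (d_bounded : bounded_map d)
    (d_proj : forall p : A, is_projection p ->
       d (p ^+ 2) = lact act (sigma p) (d p) + ract act (d p) (tau p)) :
  is_derivation act sigma tau d.
Proof.
exact: (jordan_projection_derivation sigmaM sigma_bounded tauM tau_bounded).
Qed.
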